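(* Let $M$ and $N$ be two quasianalytic weight sequences and assume $\sup_{k\in\mathbb N_{>0}}n_k^{1/k}=+\infty$ (i.e. $\mathcal O^{0,r}\subsetneq\mathcal E^{0,r}_{\{N\}}$). Then $\Lambda^r_{\{N\}}\setminus j^\infty(\mathcal E^{0,r}_{\{M\}})$ is dense in $\Lambda^r_{\{N\}}$ (and hence so is $\Lambda^r_{\{N\}}\setminus j^\infty(\mathcal E^{0,r}_{(M)})$).
   Context: For a sequence $M=(M_p)_{p\in\mathbb N}$ of positive reals write $m_p:=M_p/p!$ (and $n_p:=N_p/p!$). $M$ is a weight sequence if $1=M_0\le M_1$, $M_p^2\le M_{p-1}M_{p+1}$ for all $p\ge1$, and $\liminf_{p\to\infty}m_p^{1/p}>0$; it is quasianalytic if $\sum_{p\ge1}M_{p-1}/M_p=+\infty$. For $U\subseteq\mathbb R^r$ open, $K\subseteq U$ compact, $h>0$: $\|f\|^M_{K,h}:=\sup_{\alpha\in\mathbb N^r,x\in K}|\partial^\alpha f(x)|/(h^{|\alpha|}M_{|\alpha|})$. $\mathcal E_{\{M\}}(U)$ consists of smooth $f$ such that for every compact $K\subseteq U$ there exists $h>0$ with $\|f\|^M_{K,h}<\infty$; $\mathcal E_{(M)}(U)$: for every compact $K$ and every $h>0$. $\mathcal E^{0,r}_{\{M\}}$, $\mathcal E^{0,r}_{(M)}$ are the spaces of germs at $0\in\mathbb R^r$ of functions in the respective class on some cube $(-1/k,1/k)^r$; $\mathcal O^{0,r}$ denotes germs at $0$ of real analytic functions. For $\mathbf b=(b_\alpha)_{\alpha\in\mathbb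 N^r}$ and $h>0$: $|\mathbf b|^N_h:=\sup_\alpha|b_\alpha|/(h^{|\alpha|}n_{|\alpha|})$; $\Lambda^r_{\{N\}}:=\{\mathbf b:\exists h>0,|\mathbf b|^N_h<\infty\}$, endowed with the inductive limit topology of the Banach spaces $\{\mathbf b:|\mathbf b|^N_h<\infty\}$, $h>0$ (an (LB)-space). The Borel map is $j^\infty(f)=(\partial^\alpha f(0)/|\alpha|!)_{\alpha\in\mathbb N^r}$. *)

(* Defs.v *)
From Stdlib Require Import Reals List Arith.
Open Scope R_scope.

(* Points of R^r are encoded as x : nat -> R with x i = 0 for i >= r. *)
Definition ptR (r : nat) (x : nat -> R) : Prop := forall i, (r <= i)%nat -> x i = 0.

(* Multi-indices alpha in N^r are encoded as alpha : nat -> nat with alpha i = 0 for i >= r. *)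
Definition mindex (r : nat) (a : nat -> nat) : Prop := forall i, (r <= i)%nat -> a i = 0%nat.

Fixpoint mlen (r : nat) (a : nat -> nat) : nat :=
  match r with O => O | S r' => (mlen r' a + a r')%nat end.

Definition mzero : nat -> nat := fun _ => O.
Definition mincr (a : nat -> nat) (i : nat) : nat -> nat :=
  fun j => if Nat.eqb j i then S (a j) else a j.
Definition pzero : nat -> R := fun _ => 0.
Definition upd (x : nat -> R) (i : nat) (t : R) : nat -> R :=
  fun j => if Nat.eqb j i then t else x j.

Definition near (r : nat) (x y : nat -> R) (d : R) : Prop :=
  forall i, (i < r)%nat -> Rabs (y i - x i) < d.

Definition openR (r : nat) (O : (nat -> R) -> Prop) : Prop :=
  forall x, ptR r x -> O x ->
    exists d, 0 < d /\ forall y, ptR r y -> near r x y d -> O y.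

Definition compactR (r : nat) (K : (nat -> R) -> Prop) : Prop :=
  (forall x, K x -> ptR r x) /\
  forall (I : Type) (O : I -> (nat -> R) -> Prop),
    (forall i, openR r (O i)) -> (forall x, K x -> exists i, O i x) ->
    exists l : list I, forall x, K x -> exists i, In i l /\ O i x.

Definition cont_on (r : nat) (U : (nat -> R) -> Prop) (g : (nat -> R) -> R) : Prop :=
  forall x, U x -> forall eps, 0 < eps ->
    exists d, 0 < d /\ forall y, U y -> near r x y d -> Rabs (g y - g x) < eps.

Definition cube (r k : nat) (x : nat -> R) : Prop :=
  ptR r x /\ forall i, (i < r)%nat -> Rabs (x i) < / INR k.

Definition smooth_with (r : nat) (U : (nat -> R) -> Prop) (f : (nat -> R) -> R)
    (D : (nat -> nat) -> (nat -> R) -> R) : Prop :=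
  (forall x, U x -> D mzero x = f x) /\
  (forall a, mindex r a -> forall i, (i < r)%nat -> forall x, U x ->
     derivable_pt_lim (fun t => D a (upd x i t)) (x i) (D (mincr a i) x)) /\
  (forall a, mindex r a -> cont_on r U (D a)).

Definition normM_finite (r : nat) (M : nat -> R) (D : (nat -> nat) -> (nat -> R) -> R)
    (K : (nat -> R) -> Prop) (h : R) : Prop :=
  exists C, forall a, mindex r a -> forall x, K x ->
    Rabs (D a x) <= C * (h ^ mlen r a * M (mlen r a)).

Definition Roumieu_on (r : nat) (M : nat -> R) (U : (nat -> R) -> Prop)
    (D : (nat -> nat) -> (nat -> R) -> R) : Prop :=
  forall K, compactR r K -> (forall x, K x -> U x) ->
    exists h, 0 < h /\ normM_finite r M D K h.

Definition Beurling_on (r : nat) (M : nat -> R) (U : (nat -> R) -> Prop)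
    (D : (nat -> nat) -> (nat -> R) -> R) : Prop :=
  forall K, compactR r K -> (forall x, K x -> U x) ->
    forall h, 0 < h -> normM_finite r M D K h.

(* b = j^infty(f) for some germ f in E^{0,r}_{M}, resp. E^{0,r}_{(M)}; only
   the entries b_alpha for genuine multi-indices alpha matter. *)
Definition jet_of (r : nat) (D : (nat -> nat) -> (nat -> R) -> R) (b : (nat -> nat) -> R) : Prop :=
  forall a, mindex r a -> b a = D a pzero / INR (fact (mlen r a)).

Definition in_jet_Roumieu (r : nat) (M : nat -> R) (b : (nat -> nat) -> R) : Prop :=
  exists k f D, (1 <= k)%nat /\ smooth_with r (cube r k) f D /\
    Roumieu_on r M (cube r k) D /\ jet_of r D b.

Definition in_jet_Beurling (r : nat) (M : nat -> R) (b : (nat -> nat) -> R) : Prop :=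
  exists k f D, (1 <= k)%nat /\ smooth_with r (cube r k) f D /\
    Beurling_on r M (cube r k) D /\ jet_of r D b.

Definition nrm (N : nat -> R) (p : nat) : R := N p / INR (fact p).

Definition seq_bound (r : nat) (N : nat -> R) (h c : R) (b : (nat -> nat) -> R) : Prop :=
  forall a, mindex r a -> Rabs (b a) <= c * (h ^ mlen r a * nrm N (mlen r a)).

Definition inLambda (r : nat) (N : nat -> R) (b : (nat -> nat) -> R) : Prop :=
  exists h c, 0 < h /\ seq_bound r N h c b.

Definition abs_convex (V : ((nat -> nat) -> R) -> Prop) : Prop :=
  forall x y (l m : R), V x -> V y -> Rabs l + Rabs m <= 1 ->
    V (fun a => l * x a + m * y a).

(* 0-neighbourhoods of the locally convex inductive limit topology of
   Lambda^r_{N}: absolutely convex sets containing a ball of every step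
   Banach space {b : |b|^N_h < infinity}. *)
Definition LB_zero_nbhd (r : nat) (N : nat -> R) (V : ((nat -> nat) -> R) -> Prop) : Prop :=
  abs_convex V /\
  forall h, 0 < h -> exists eps, 0 < eps /\ forall c, seq_bound r N h eps c -> V c.

Definition dense_Lambda (r : nat) (N : nat -> R) (S : ((nat -> nat) -> R) -> Prop) : Prop :=
  forall b, inLambda r N b -> forall V, LB_zero_nbhd r N V ->
    exists s, inLambda r N s /\ S s /\ V (fun a => s a - b a).

Definition weight_sequence (M : nat -> R) : Prop :=
  (forall p, 0 < M p) /\ M 0%nat = 1 /\ M 0%nat <= M 1%nat /\
  (forall p, (1 <= p)%nat -> (M p) ^ 2 <= M (p - 1)%nat * M (p + 1)%nat) /\
  (exists c, 0 < c /\ exists p0, forall p, (p0 <= p)%nat -> (1 <= p)%nat ->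
     c <= Rpower (nrm M p) (/ INR p)).

Definition quasianalytic (M : nat -> R) : Prop :=
  forall B, exists n, B < sum_f_R0 (fun k => M k / M (S k)) n.

(* Main.v *)
Require Import Defs.
From Stdlib Require Import Reals.
From Stdlib Require Import Ranalysis5 Lra Lia Arith List.
From Stdlib Require Import Classical ClassicalEpsilon FunctionalExtensionality.
Open Scope R_scope.

(** The jets of the class [M] that lie in [Lambda_N] form a linear subspace, so
    it is enough to find a single element of [Lambda_N] outside it: a small
    multiple of that element moves any jet out of the subspace.  The element is
    [b_alpha = n_|alpha|].  If it were the jet of [f], the restriction [g] of [f]
    to the first axis would satisfy [g^(p)(0) = N_p > 0] for all [p].

    Bang's argument then gives [g^(p) >= 0] on some [[0, d]] for all [p].  Up to
    replacing [g] by [g^(p)], suppose that [g(z_0) < 0].  The intermediate and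
    mean value theorems produce a decreasing sequence [z_k] in [[0, d]] with
    [g^(k)(z_(k+1)) = 0].  Moving right from [z_n] to [z_0], the quantity
    [sup_(j >= k) |g^(j)| / (e^j M_j)], with [k] lowered by one at each of these
    zeros, needs length [M_N / (e M_(N+1))] to grow from [e^-(N+1)] to [e^-N].
    These lengths have an infinite sum and [n] is arbitrary, so the quantity is
    arbitrarily small at [z_0], where [g] therefore vanishes.

    Nonnegativity of all derivatives yields [n_p d^p <= g(d)] for all [p], against
    [sup n_p^(1/p) = +oo]. *)

(** * Weights, chains of derivatives and mean value estimates *)

Definition log_convex (W : nat -> R) : Prop :=
  forall p, W (S p) * W (S p) <= W p * W (S (S p)).

Definition deriv_chain (d : R) (F : nat -> R -> R) : Prop :=
  forall p t, 0 <= t <= d -> derivable_pt_lim (F p) t (F (S p) t).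

(** Bang's quantity $\sup_{j\ge k}|F_j(x)|/(e^jW_j)\le c$, written without supremum or division. The
    factor $e^j$ makes it at most $e^{-k}$ whenever $|F_j|\le W_j$. *)
Definition tail_bound (W : nat -> R) (F : nat -> R -> R) (k : nat) (x c : R) : Prop :=
  forall j, (k <= j)%nat -> Rabs (F j x) <= c * (exp (INR j) * W j).

(** Both [h - g] and [h + g] have nonnegative derivative. This takes the place of integrating a
    bound on [g']. *)
Lemma Rabs_increment_le (g g' h h' : R -> R) (x t : R) :
  x <= t ->
  (forall s, x <= s <= t -> derivable_pt_lim g s (g' s)) ->
  (forall s, x <= s <= t -> derivable_pt_lim h s (h' s)) ->
  (forall s, x <= s <= t -> Rabs (g' s) <= h' s) ->
  Rabs (g t - g x) <= h t - h x.
Proof.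
  intros [Hxt | <-] Hg Hh Hle.
  2: { rewrite !Rminus_diag, Rabs_R0; lra. }
  destruct (MVT_cor2 (fun s => h s - g s) (fun s => h' s - g' s) x t Hxt)
    as [c [Hc1 Hc]].
  { intros s Hs. apply derivable_pt_lim_minus; auto. }
  destruct (MVT_cor2 (fun s => h s + g s) (fun s => h' s + g' s) x t Hxt)
    as [c' [Hc1' Hc']].
  { intros s Hs. apply derivable_pt_lim_plus; auto. }
  assert (H1 := Hle c ltac:(lra)). assert (H2 := Hle c' ltac:(lra)).
  assert (H3 := Rle_abs (g' c)). assert (H4 := Rle_abs (- g' c')).
  rewrite Rabs_Ropp in H4.
  apply Rabs_le. split; nra.
Qed.

(** Log-convexity makes the quotients increase, so one growth rate serves all orders up to [N]. *)
Lemma ratio_le (W : nat -> R) (N j : nat) :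
  (forall p, 0 < W p) -> log_convex W -> (j <= N)%nat ->
  W (S j) / W j <= W (S N) / W N.
Proof.
  intros Hpos Hlc. induction 1 as [|m Hm IH]; [lra|].
  apply Rle_trans with (1 := IH).
  assert (H1 := Hpos m). assert (H2 := Hpos (S m)). assert (H3 := Hlc m).
  apply Rmult_le_reg_r with (W m * W (S m)); [nra|].
  replace (W (S m) / W m * (W m * W (S m))) with (W (S m) * W (S m)) by (field; lra).
  replace (W (S (S m)) / W (S m) * (W m * W (S m))) with (W m * W (S (S m))) by (field; lra).
  exact H3.
Qed.

Lemma exp_mono (x y : R) : x <= y -> exp x <= exp y.
Proof.
  intros [H | ->]; [left; now apply exp_increasing | lra].
Qed.

Lemma exp_scaled_deriv (K A x s : R) :
  derivable_pt_lim (fun u => K * exp (A * (u - x))) s (K * (A * exp (A * (s - x)))).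
Proof.
  apply (derivable_pt_lim_scal (fun u => exp (A * (u - x)))).
  replace (A * exp (A * (s - x))) with (exp (A * (s - x)) * A) by ring.
  apply (derivable_pt_lim_comp (fun u => A * (u - x)) exp).
  - enough (H : derivable_pt_lim (fun u => A * (u - x)) s (A * (1 - 0)))
      by (rewrite Rminus_0_r, Rmult_1_r in H; exact H).
    apply (derivable_pt_lim_scal (fun u => u - x)).
    apply derivable_pt_lim_minus;
      [apply derivable_pt_lim_id | apply derivable_pt_lim_const].
  - apply derivable_pt_lim_exp.
Qed.

(** * Bang's argument along a decreasing chain of zeros *)

Section Bang.

Variables (d : R) (W : nat -> R) (F : nat -> R -> R).
Hypothesis Wpos : forall p, 0 < W p.
Hypothesis Wlc : log_convex W.
Hypothesis Fder : deriv_chain d F.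
Hypothesis Fbound : forall p t, 0 <= t <= d -> Rabs (F p t) <= W p.

Lemma tail_bound_trivial (k : nat) (x : R) :
  0 <= x <= d -> tail_bound W F k x (exp (- INR k)).
Proof.
  intros Hx j Hj.
  rewrite <- Rmult_assoc, <- exp_plus.
  assert (H := Fbound j x Hx). assert (HW := Wpos j).
  assert (1 <= exp (- INR k + INR j)).
  { rewrite <- exp_0. apply exp_mono. apply le_INR in Hj. lra. }
  nra.
Qed.

Lemma tail_bound_le (k k' : nat) (x c c' : R) :
  (k <= k')%nat -> c <= c' -> tail_bound W F k x c -> tail_bound W F k' x c'.
Proof.
  intros Hk Hc H j Hj. apply Rle_trans with (1 := H j ltac:(lia)).
  apply Rmult_le_compat_r; [|exact Hc].
  assert (H1 := Wpos j). assert (H2 := exp_pos (INR j)). nra.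
Qed.

(** Only the entry of order [k] is new, and it vanishes: a zero lowers the index at no cost. *)
Lemma tail_bound_at_zero (k : nat) (x c : R) :
  0 <= c -> F k x = 0 -> tail_bound W F (S k) x c -> tail_bound W F k x c.
Proof.
  intros Hc H0 H j Hj. destruct (Nat.eq_dec j k) as [-> | Hne].
  - rewrite H0, Rabs_R0. assert (H1 := Wpos k). assert (H2 := exp_pos (INR k)).
    apply Rmult_le_pos; nra.
  - apply H; lia.
Qed.

(** A Gronwall estimate by descending induction on the order. From order [S N] on, the trivial bound
    $e^{-j}\le c$ suffices; below that, the bound for order [j + 1] is integrated from [x]. *)
Lemma tail_bound_growth (k N : nat) (x t c : R) :
  0 <= x -> x <= t -> t <= d -> exp (- INR (S N)) <= c ->
  tail_bound W F k x c ->
  tail_bound W F k t (c * exp (exp 1 * (W (S N) / W N) * (t - x))).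
Proof.
  intros Hx Hxt Htd Hc HB.
  set (A := exp 1 * (W (S N) / W N)).
  assert (HA : 0 < A).
  { apply Rmult_lt_0_compat; [apply exp_pos|]. apply Rdiv_lt_0_compat; auto. }
  assert (Hc0 : 0 < c) by (assert (H := exp_pos (- INR (S N))); lra).
  (* Here [m] bounds the number of orders from [j] up to [S N]. *)
  assert (Hmain : forall m j s, (k <= j)%nat -> (S N <= j + m)%nat -> x <= s <= d ->
            Rabs (F j s) <= c * exp (A * (s - x)) * (exp (INR j) * W j)).
  { induction m as [|m IH]; intros j s Hkj Hm Hs.
    - assert (H1 := tail_bound_trivial j s ltac:(lra) j ltac:(lia)).
      apply Rle_trans with (1 := H1).
      apply Rmult_le_compat_r.
      { assert (H2 := Wpos j). assert (H3 := exp_pos (INR j)). nra. }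
      assert (exp (- INR j) <= c).
      { apply Rle_trans with (2 := Hc). apply exp_mono.
        assert (H2 := le_INR (S N) j ltac:(lia)). lra. }
      assert (1 <= exp (A * (s - x))).
      { rewrite <- exp_0. apply exp_mono. nra. }
      nra.
    - destruct (le_lt_dec (S N) j) as [HNj | HNj].
      { apply IH; lia || lra. }
      set (K := c * (exp (INR j) * W j)).
      assert (Hinc : Rabs (F j s - F j x)
                     <= K * exp (A * (s - x)) - K * exp (A * (x - x))).
      { apply (Rabs_increment_le (F j) (F (S j))
                 (fun u => K * exp (A * (u - x)))
                 (fun u => K * (A * exp (A * (u - x))))); try lra.
        - intros u Hu. apply Fder. lra.
        - intros u _. apply exp_scaled_deriv.
        - intros u Hu.
          apply Rle_trans with (1 := IH (S j) u ltac:(lia) ltac:(lia) ltac:(lra)).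
          (* Relative to the weights $e^jW_j$, the derivative costs the factor $eW_{j+1}/W_j$, which
             is at most [A]. *)
          assert (HR := ratio_le W N j Wpos Wlc ltac:(lia)).
          replace (exp (INR (S j))) with (exp 1 * exp (INR j))
            by (rewrite S_INR, Rplus_comm, exp_plus; reflexivity).
          replace (c * exp (A * (u - x)) * (exp 1 * exp (INR j) * W (S j)))
            with (K * exp (A * (u - x)) * (exp 1 * (W (S j) / W j)))
            by (unfold K; field; assert (H := Wpos j); lra).
          replace (K * (A * exp (A * (u - x)))) with (K * exp (A * (u - x)) * A) by ring.
          apply Rmult_le_compat_l.
          + assert (H1 := exp_pos (A * (u - x))). assert (H2 := exp_pos (INR j)).
            assert (H3 := Wpos j). unfold K.
            repeat apply Rmult_le_pos; lra.
          + apply Rmult_le_compat_l; [assert (H := exp_pos 1); lra | exact HR]. }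
      assert (HFx := HB j Hkj). fold K in HFx.
      rewrite Rminus_diag, Rmult_0_r, exp_0 in Hinc.
      assert (Htri := Rabs_triang (F j s - F j x) (F j x)).
      replace (F j s - F j x + F j x) with (F j s) in Htri by ring.
      replace (c * exp (A * (s - x)) * (exp (INR j) * W j))
        with (K * exp (A * (s - x))) by (unfold K; ring).
      lra. }
  intros j Hj. apply (Hmain (S N)); lia || lra.
Qed.

Variable z : nat -> R.
Hypothesis zrange : forall k, 0 <= z k <= d.
Hypothesis zdecr : forall k, z (S k) < z k.
Hypothesis zzero : forall k, F k (z (S k)) = 0.

Let T := sum_f_R0 (fun k => W k / W (S k)).

Lemma zeros_antitone (m n : nat) : (m <= n)%nat -> z n <= z m.
Proof.
  induction 1 as [|n Hn IH]; [lra|]. assert (H := zdecr n). lra.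
Qed.

(* Rising from level [e^-(N+1)] to [e^-N] costs length [W N / (e W (N+1))]; the
   statement counts only [(T (N+1) - T N) / e = W (N+1) / (e W (N+2))], which is
   smaller by log-convexity. *)
Lemma tail_bound_level (n m N : nat) :
  (N + m)%nat = n ->
  forall k t, (k <= n)%nat -> z (S k) < t <= z k ->
    t <= z n + (T n - T N) / exp 1 -> tail_bound W F k t (exp (- INR N)).
Proof.
  revert N. induction m as [|m IH]; intros N HN k t Hk Ht Hle.
  - assert (N = n) by lia. subst N.
    unfold Rdiv in Hle. rewrite Rminus_diag, Rmult_0_l, Rplus_0_r in Hle.
    destruct (Nat.eq_dec k n) as [-> | Hne].
    + apply tail_bound_trivial. assert (H := zrange n). assert (H' := zrange (S n)). lra.
    + assert (H := zeros_antitone (S k) n ltac:(lia)). lra.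
  - specialize (IH (S N) ltac:(lia)).
    (* Up to [a] the induction hypothesis already gives the better level $e^{-(N+1)}$. *)
    set (a := z n + (T n - T (S N)) / exp 1) in *.
    set (A := exp 1 * (W (S N) / W N)).
    assert (He := exp_pos 1).
    assert (HT : forall i, T (S i) = T i + W (S i) / W (S (S i))) by reflexivity.
    assert (Hterm : forall i, 0 < W i / W (S i)) by (intro; apply Rdiv_lt_0_compat; auto).
    assert (HTmono : forall i j, (i <= j)%nat -> T i <= T j).
    { induction 1 as [|j Hij IHj]; [lra|].
      rewrite HT. assert (H := Hterm (S j)). lra. }
    assert (Han : z n <= a).
    { unfold a. assert (H := HTmono (S N) n ltac:(lia)).
      assert (0 <= (T n - T (S N)) / exp 1)
        by (apply Rmult_le_pos; [lra|left; now apply Rinv_0_lt_compat]).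
      lra. }
    (* Beyond [a] the quantity grows at rate at most [A]. The induction runs over the intervals
       $(z_{k+1},z_k]$ from left to right, [q] being [n - k]. *)
    assert (Hgrow : forall q k t, (q + k)%nat = n -> z (S k) < t <= z k -> a <= t ->
              tail_bound W F k t (exp (- INR (S N)) * exp (A * (t - a)))).
    (* For [k' = n] the inequalities [t' <= z n <= a <= t'] leave only [t' = a]. *)
    { induction q as [|q IHq]; intros k' t' Hq Ht' Hat.
      - assert (k' = n) by lia. subst k'.
        assert (t' = a) by lra. subst t'.
        rewrite Rminus_diag, Rmult_0_r, exp_0, Rmult_1_r.
        apply IH; try lia; lra.
      - assert (Hr := zrange k'). assert (Hr' := zrange (S k')). assert (Hr'' := zrange n).
        (* If [a] lies inside or to the right of the current interval, growth starts at [a].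
           Otherwise it starts at the left endpoint, where the bound of the previous interval passes
           from index [S k'] to [k'] because [F k'] vanishes. *)
        destruct (Rlt_le_dec (z (S k')) a) as [Hlt | Hge].
        + apply tail_bound_growth; try lra.
          apply IH; try lia; lra.
        + assert (HA : 0 <= A).
          { apply Rmult_le_pos; [lra|]. left. apply Rdiv_lt_0_compat; auto. }
          assert (HS : tail_bound W F k' (z (S k'))
                    (exp (- INR (S N)) * exp (A * (z (S k') - a)))).
          { apply tail_bound_at_zero; [|apply zzero|].
            - left. apply Rmult_lt_0_compat; apply exp_pos.
            - apply IHq; [lia| |exact Hge]. assert (H := zdecr (S k')). lra. }
          assert (H1 : 1 <= exp (A * (z (S k') - a))).
          { rewrite <- exp_0. apply exp_mono. apply Rmult_le_pos; lra. }
          assert (H2 := exp_pos (- INR (S N))).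
          assert (HG := tail_bound_growth k' N (z (S k')) t'
                          (exp (- INR (S N)) * exp (A * (z (S k') - a)))
                          ltac:(lra) ltac:(lra) ltac:(lra) ltac:(nra) HS).
          fold A in HG.
          rewrite Rmult_assoc, <- exp_plus in HG.
          replace (A * (z (S k') - a) + A * (t' - z (S k'))) with (A * (t' - a)) in HG by ring.
          exact HG. }
    destruct (Rle_lt_dec t a) as [Hta | Hta].
    + apply tail_bound_le with (k := k) (c := exp (- INR (S N))); [lia| |apply IH; auto].
      apply exp_mono. rewrite S_INR. lra.
    + apply tail_bound_le with (k := k) (c := exp (- INR (S N)) * exp (A * (t - a))); [lia| |].
      2: { apply (Hgrow (n - k)%nat); [lia|exact Ht|lra]. }
      rewrite <- exp_plus. apply exp_mono. rewrite S_INR.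
      (* The remaining length is at most $W_{N+1}/(eW_{N+2})$, so the exponent is at most
         $W_{N+1}^2/(W_NW_{N+2})\le1$: one level is lost. *)
      assert (A * (t - a) <= 1); [|lra].
      assert (H1 : t - a <= (W (S N) / W (S (S N))) / exp 1).
      { unfold a. rewrite HT in *.
        replace (z n + (T n - T N) / exp 1) with
          (z n + (T n - (T N + W (S N) / W (S (S N)))) / exp 1
           + (W (S N) / W (S (S N))) / exp 1)
          in Hle by (field; split; [|assert (H := Wpos (S (S N)))]; lra).
        lra. }
      assert (HW0 := Wpos N). assert (HW1 := Wpos (S N)). assert (HW2 := Wpos (S (S N))).
      apply Rle_trans with (A * ((W (S N) / W (S (S N))) / exp 1)).
      { apply Rmult_le_compat_l; [|exact H1].
        apply Rmult_le_pos; [lra|]. left. apply Rdiv_lt_0_compat; auto. }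
      unfold A.
      replace (exp 1 * (W (S N) / W N) * (W (S N) / W (S (S N)) / exp 1))
        with ((W (S N) * W (S N)) / (W N * W (S (S N)))) by (field; lra).
      apply Rmult_le_reg_r with (W N * W (S (S N))); [nra|].
      unfold Rdiv. rewrite Rmult_assoc, Rinv_l by nra.
      assert (H := Wlc N). lra.
Qed.

Lemma quasianalytic_zero_chain : quasianalytic W -> F 0%nat (z 0%nat) = 0.
Proof.
  intros Hqa.
  assert (He := exp_pos 1).
  assert (Hlev : forall N, Rabs (F 0%nat (z 0%nat)) <= exp (- INR N) * W 0%nat).
  { intros N. destruct (Hqa (T N + exp 1 * z 0%nat)) as [n Hn]. fold T in Hn.
    assert (Hz0 := zrange 0). assert (Hzn := zrange n).
    assert (HNn : (N <= n)%nat).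
    { destruct (le_lt_dec N n) as [|Hlt]; [assumption|exfalso].
      assert (T n <= T N).
      { clear - Hlt Wpos. induction Hlt as [|q Hq IH]; simpl.
        - assert (H : 0 < W (S n) / W (S (S n))) by (apply Rdiv_lt_0_compat; auto).
          unfold T. simpl. lra.
        - assert (H : 0 < W (S q) / W (S (S q))) by (apply Rdiv_lt_0_compat; auto).
          unfold T in *. simpl. lra. }
      assert (0 <= exp 1 * z 0%nat) by (apply Rmult_le_pos; lra). lra. }
    assert (HB := tail_bound_level n (n - N) N ltac:(lia) 0 (z 0%nat) ltac:(lia)).
    assert (Hz1 := zdecr 0).
    specialize (HB ltac:(lra)).
    assert (Hle : z 0%nat <= (T n - T N) / exp 1).
    { apply Rmult_le_reg_r with (exp 1); [lra|].
      unfold Rdiv. rewrite Rmult_assoc, Rinv_l by lra. lra. }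
    specialize (HB ltac:(lra) 0%nat ltac:(lia)).
    simpl (INR 0) in HB. rewrite exp_0 in HB. lra. }
  destruct (Req_dec (F 0%nat (z 0%nat)) 0) as [|Hne]; [assumption|exfalso].
  assert (Hp := Rabs_pos_lt _ Hne). set (v := Rabs _) in *.
  assert (HW := Wpos 0).
  destruct (INR_unbounded (W 0%nat / v)) as [N HN].
  specialize (Hlev N).
  (* The inequality $1+N\le e^N$ turns $v\le e^{-N}W_0$ into a contradiction with $N>W_0/v$. *)
  assert (H1 := exp_ineq1_le (INR N)).
  assert (H2 : exp (- INR N) * exp (INR N) = 1)
    by (rewrite <- exp_plus, Rplus_opp_l; apply exp_0).
  assert (H3 := exp_pos (INR N)).
  assert (H4 : v * exp (INR N) <= W 0%nat).
  { replace (W 0%nat) with (exp (- INR N) * W 0%nat * exp (INR N)).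
    - apply Rmult_le_compat_r; lra.
    - rewrite Rmult_comm, <- Rmult_assoc, (Rmult_comm (exp (INR N))), H2. ring. }
  assert (H5 : W 0%nat < INR N * v).
  { apply Rmult_lt_reg_r with (/ v); [now apply Rinv_0_lt_compat|].
    rewrite Rmult_assoc, Rinv_r by lra. unfold Rdiv in HN. lra. }
  nra.
Qed.

End Bang.

(** * Nonnegativity of a quasianalytic function whose derivatives at 0 are positive *)

Lemma deriv_chain_continuous (d : R) (F : nat -> R -> R) (p : nat) (t : R) :
  deriv_chain d F -> 0 <= t <= d -> continuity_pt (F p) t.
Proof.
  intros HF Ht. apply derivable_continuous_pt.
  exists (F (S p) t). apply HF, Ht.
Qed.

(** One link of the chain of zeros: the intermediate value theorem gives [x], and the fall of [F k]
    from a positive value at 0 to zero at [x] gives [y']. The output at [y'] has the form of the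
    input, one order higher. *)
Lemma zero_then_negative_derivative (d : R) (F : nat -> R -> R) (k : nat) (y : R) :
  deriv_chain d F -> (forall p, 0 < F p 0) ->
  0 < y <= d -> F k y < 0 ->
  exists x y', 0 < y' < x /\ x < y /\ F k x = 0 /\ F (S k) y' < 0.
Proof.
  intros HF H0 Hy Hneg.
  destruct (IVT_interv (fun t => - F k t) 0 y) as [x [Hx Hx0]].
  - intros a Ha. apply continuity_pt_opp. apply (deriv_chain_continuous d); [exact HF|lra].
  - lra.
  - assert (H := H0 k). lra.
  - lra.
  - assert (HFx : F k x = 0) by lra.
    assert (Hk := H0 k).
    assert (0 < x) by (destruct (proj1 Hx) as [|<-]; lra).
    assert (x < y) by (destruct (proj2 Hx) as [| ->]; lra).
    destruct (MVT_cor2 (F k) (F (S k)) 0 x) as [y' [Hy'1 Hy']]; [lra| |].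
    { intros c Hc. apply HF. lra. }
    exists x, y'. repeat split; try lra. nra.
Qed.

Lemma quasianalytic_nonneg (d : R) (W : nat -> R) (F : nat -> R -> R) :
  (forall p, 0 < W p) -> log_convex W -> quasianalytic W ->
  deriv_chain d F -> (forall p t, 0 <= t <= d -> Rabs (F p t) <= W p) ->
  (forall p, 0 < F p 0) ->
  forall t, 0 <= t <= d -> 0 <= F 0%nat t.
Proof.
  intros HW Hlc Hqa HF Hb H0 y Hy.
  destruct (Rle_lt_dec 0 (F 0%nat y)) as [|Hneg]; [assumption|exfalso].
  assert (Hy0 : 0 < y).
  { destruct (proj1 Hy) as [|<-]; [assumption|]. assert (H := H0 0%nat). lra. }
  (* A state is an order and a point where that derivative is negative; carrying the proof allows
     the link to be iterated after a choice. *)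
  set (st := {q : nat * R | 0 < snd q <= d /\ F (fst q) (snd q) < 0}).
  assert (Hstep : forall q : st, exists xq : R * st,
    fst (proj1_sig (snd xq)) = S (fst (proj1_sig q)) /\
    0 < snd (proj1_sig (snd xq)) < fst xq /\ fst xq < snd (proj1_sig q) /\
    F (fst (proj1_sig q)) (fst xq) = 0).
  { intros [[k u] [Hu Hn]]. simpl in *.
    destruct (zero_then_negative_derivative d F k u HF H0 Hu Hn) as (x & y' & H1 & H2 & H3 & H4).
    assert (Hq : 0 < snd (S k, y') <= d /\ F (fst (S k, y')) (snd (S k, y')) < 0)
      by (simpl; split; lra).
    exists (x, exist _ (S k, y') Hq). simpl. repeat split; lra. }
  set (g := fun q => proj1_sig (constructive_indefinite_description _ (Hstep q))).
  assert (Hg := fun q => proj2_sig (constructive_indefinite_description _ (Hstep q))).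
  change (forall q : st, fst (proj1_sig (snd (g q))) = S (fst (proj1_sig q)) /\
    0 < snd (proj1_sig (snd (g q))) < fst (g q) /\ fst (g q) < snd (proj1_sig q) /\
    F (fst (proj1_sig q)) (fst (g q)) = 0) in Hg.
  clearbody g.
  set (q0 := exist _ (0%nat, y) (conj (conj Hy0 (proj2 Hy)) Hneg) : st).
  set (q := fun k => Nat.iter k (fun s => snd (g s)) q0).
  assert (Hfst : forall k, fst (proj1_sig (q k)) = k).
  { induction k as [|k IH]; [reflexivity|].
    change (q (S k)) with (snd (g (q k))). rewrite (proj1 (Hg (q k))), IH. reflexivity. }
  (* The shift by one matches the zero-chain lemma: [z (S k)] is the zero of [F k], while [z 0] is
     the assumed negative point. *)
  set (z := fun k => match k with O => y | S k' => fst (g (q k')) end).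
  assert (Hzq : forall k, 0 < fst (g (q k)) < snd (proj1_sig (q k))).
  { intro k. destruct (Hg (q k)) as (_ & H1 & H2 & _). lra. }
  assert (Hqd : forall k, snd (proj1_sig (q k)) <= d).
  { intro k. destruct (q k) as [u Hu]. simpl. lra. }
  assert (HFy : F 0%nat (z 0%nat) = 0).
  { apply (quasianalytic_zero_chain d W F HW Hlc HF Hb z); [| | |exact Hqa].
    - intros [|k]; simpl; [lra|]. assert (H1 := Hzq k). assert (H2 := Hqd k). lra.
    - intros [|k]; simpl; [exact (proj2 (Hzq 0%nat))|].
      assert (H1 := Hzq (S k)). destruct (Hg (q k)) as (_ & H2 & _).
      change (q (S k)) with (snd (g (q k))) in *. lra.
    - intros k. simpl. destruct (Hg (q k)) as (_ & _ & _ & H). rewrite Hfst in H. exact H. }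
  simpl in HFy. lra.
Qed.

(** * Permanence of quasianalyticity and a Taylor lower bound *)

Lemma quasianalytic_shift (W : nat -> R) (p : nat) :
  quasianalytic W -> quasianalytic (fun j => W (p + j)%nat).
Proof.
  intros H. induction p as [|p IH]; [exact H|].
  intros B. set (u := fun k => W (p + k)%nat / W (p + S k)%nat).
  (* The absolute value pays for the dropped first term; the maximum with 0 rules out [n = 0]. *)
  destruct (IH (Rmax B 0 + Rabs (u 0%nat))) as [n Hn].
  fold u in Hn.
  assert (H1 := RRle_abs (u 0%nat)).
  assert (H2 := Rmax_l B 0). assert (H3 := Rmax_r B 0).
  destruct n as [|n]; [simpl in Hn; lra|].
  exists n. rewrite decomp_sum in Hn by lia. simpl pred in Hn.
  replace (sum_f_R0 (fun k => W (S p + k)%nat / W (S p + S k)%nat) n)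
    with (sum_f_R0 (fun i => u (S i)) n); [lra|].
  apply sum_eq. intros i _. unfold u.
  replace (p + S i)%nat with (S p + i)%nat by lia.
  replace (p + S (S i))%nat with (S p + S i)%nat by lia. reflexivity.
Qed.

Lemma quasianalytic_scale (W : nat -> R) (C h : R) :
  (forall p, 0 < W p) -> 0 < C -> 0 < h ->
  quasianalytic W -> quasianalytic (fun j => C * (h ^ j * W j)).
Proof.
  intros HW HC Hh H B. destruct (H (B * h)) as [n Hn]. exists n.
  replace (sum_f_R0 _ n) with (/ h * sum_f_R0 (fun k => W k / W (S k)) n).
  - apply Rmult_lt_reg_l with h; [exact Hh|].
    rewrite <- Rmult_assoc, Rinv_r, Rmult_1_l by lra. lra.
  - rewrite scal_sum. apply sum_eq. intros i _. simpl.
    assert (H1 := HW i). assert (H2 := HW (S i)). assert (H3 := pow_lt h i Hh).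
    field. lra.
Qed.

(** Induction on [m]: after subtracting the Taylor term, the derivative is nonnegative by the case
    of order [S j], and the value at 0 is still [F j 0 >= 0]. *)
Lemma nonneg_chain_taylor (d : R) (F : nat -> R -> R) (m j : nat) (t : R) :
  deriv_chain d F -> (forall p s, 0 <= s <= d -> 0 <= F p s) -> 0 <= t <= d ->
  F (j + m)%nat 0 * (t ^ m / INR (fact m)) <= F j t.
Proof.
  intros HF Hpos. revert j t. induction m as [|m IH]; intros j t Ht.
  - rewrite Nat.add_0_r. simpl. replace (F j 0 * (1 / 1)) with (F j 0) by field.
    destruct (proj1 Ht) as [Ht0 | <-]; [|lra].
    destruct (MVT_cor2 (F j) (F (S j)) 0 t Ht0) as [c [Hc1 Hc]].
    { intros; apply HF; lra. }
    assert (H := Hpos (S j) c ltac:(lra)). nra.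
  - destruct (proj1 Ht) as [Ht0 | <-].
    2: { simpl pow. unfold Rdiv. rewrite !Rmult_0_l, Rmult_0_r. apply Hpos. lra. }
    set (c0 := F (j + S m)%nat 0).
    destruct (MVT_cor2 (fun s => F j s - c0 * / INR (fact (S m)) * s ^ S m)
      (fun s => F (S j) s - c0 * / INR (fact (S m)) * (INR (S m) * s ^ m)) 0 t Ht0)
      as [c [Hc1 Hc]].
    { intros s Hs. apply derivable_pt_lim_minus; [apply HF; lra|].
      apply (derivable_pt_lim_scal (fun u => u ^ S m)).
      apply (derivable_pt_lim_pow s (S m)). }
    assert (HI := IH (S j) c ltac:(lra)).
    replace (S j + m)%nat with (j + S m)%nat in HI by lia. fold c0 in HI.
    assert (Hf : INR (fact (S m)) = INR (S m) * INR (fact m))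
      by (rewrite fact_simpl, mult_INR; reflexivity).
    assert (Hf1 := INR_fact_lt_0 m). assert (Hf2 := lt_0_INR (S m) ltac:(lia)).
    assert (He : c0 * / INR (fact (S m)) * (INR (S m) * c ^ m) = c0 * (c ^ m / INR (fact m)))
      by (rewrite Hf; field; lra).
    rewrite He in Hc1.
    assert (H0 := Hpos j 0 ltac:(lra)).
    rewrite (pow_i (S m)) in Hc1 by lia.
    unfold Rdiv. nra.
Qed.

(** * Restriction of germs to the first coordinate axis *)

Definition axis_index (p : nat) : nat -> nat := Nat.iter p (fun a => mincr a 0) mzero.

Lemma axis_index_spec (p i : nat) : axis_index p i = if Nat.eqb i 0 then p else 0%nat.
Proof.
  induction p as [|p IH].
  - now destruct (Nat.eqb i 0).
  - change (axis_index (S p)) with (mincr (axis_index p) 0). unfold mincr. rewrite IH.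
    now destruct (Nat.eqb i 0).
Qed.

Lemma mindex_axis (r p : nat) : (1 <= r)%nat -> mindex r (axis_index p).
Proof.
  intros Hr i Hi. rewrite axis_index_spec. destruct i; [lia|reflexivity].
Qed.

Lemma mlen_axis (r p : nat) : (1 <= r)%nat -> mlen r (axis_index p) = p.
Proof.
  induction 1 as [|r Hr IH].
  - simpl. now rewrite axis_index_spec.
  - simpl. rewrite IH, axis_index_spec. destruct r; [lia|]. simpl. lia.
Qed.

(** A necessary condition for jets of class $\{M\}$ that sees only a one-sided segment of the first
    axis. *)
Definition axis_jet (M : nat -> R) (b : (nat -> nat) -> R) : Prop :=
  exists d F C h, 0 < d /\ 0 < h /\ deriv_chain d F /\
    (forall p t, 0 <= t <= d -> Rabs (F p t) <= C * (h ^ p * M p)) /\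
    (forall p, b (axis_index p) = F p 0 / INR (fact p)).

(** Heine-Borel by the supremum [m] of the initial segments with a finite subcover: a set covering
    [m] carries the subcover past [m], so [m = d]. *)
Lemma compact_segment (r : nat) (d : R) :
  (1 <= r)%nat -> 0 <= d ->
  compactR r (fun x => exists t, 0 <= t <= d /\ x = upd pzero 0 t).
Proof.
  intros Hr Hd. split.
  { intros x [t [_ ->]] i Hi. unfold upd, pzero. destruct i; [lia|reflexivity]. }
  intros I O HO Hcov.
  set (E := fun t => 0 <= t <= d /\ exists l : list I, forall s, 0 <= s <= t ->
              exists i, In i l /\ O i (upd pzero 0 s)).
  assert (Hpt : forall s, ptR r (upd pzero 0 s)).
  { intros s i Hi. unfold upd, pzero. destruct i; [lia|reflexivity]. }
  assert (Hloc : forall t, 0 <= t <= d -> exists i e, 0 < e /\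
            forall s, Rabs (s - t) < e -> O i (upd pzero 0 s)).
  { intros t Ht. destruct (Hcov (upd pzero 0 t)) as [i Hi]; [now exists t|].
    destruct (HO i _ (Hpt t) Hi) as [e [He Hb]].
    exists i, e. split; [exact He|]. intros s Hs. apply Hb; [apply Hpt|].
    intros j Hj. unfold upd, pzero. destruct j; simpl; [exact Hs|].
    rewrite Rminus_diag, Rabs_R0. exact He. }
  assert (HE0 : E 0).
  { split; [lra|]. destruct (Hloc 0 ltac:(lra)) as (i & e & He & Hb).
    exists (i :: nil). intros s Hs. exists i. split; [now left|].
    apply Hb. rewrite Rabs_right; lra. }
  destruct (completeness E) as [m [Hub Hlub]].
  { exists d. intros t [Ht _]. lra. }
  { now exists 0. }
  assert (Hm : 0 <= m <= d).
  { split; [now apply Hub|]. apply Hlub. intros t [Ht _]. lra. }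
  destruct (Hloc m Hm) as (i & e & He & Hb).
  assert (Hex : exists t, E t /\ m - e < t).
  { apply NNPP. intros Hno. assert (m <= m - e); [|lra].
    apply Hlub. intros t Ht. apply Rnot_lt_le. intros Hlt. apply Hno. now exists t. }
  destruct Hex as (t & [Ht [l Hl]] & Htm).
  assert (HE : forall u, 0 <= u <= d -> u < m + e -> E u).
  { intros u Hu Hue. split; [exact Hu|]. exists (i :: l). intros s Hs.
    destruct (Rle_lt_dec s t) as [Hst | Hst].
    - destruct (Hl s ltac:(lra)) as [i' [Hi' HO']]. exists i'. split; [now right|exact HO'].
    - exists i. split; [now left|]. apply Hb. apply Rabs_def1; lra. }
  assert (m = d).
  { destruct (proj2 Hm) as [Hlt|]; [exfalso|assumption].
    assert (H1 := Rmin_l d (m + e / 2)). assert (H2 := Rmin_r d (m + e / 2)).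
    assert (H3 : m < Rmin d (m + e / 2)) by (apply Rmin_glb_lt; lra).
    assert (H4 := Hub _ (HE (Rmin d (m + e / 2)) ltac:(lra) ltac:(lra))). lra. }
  destruct (HE d ltac:(lra) ltac:(lra)) as [_ [l' Hl']].
  exists l'. intros x [s [Hs ->]]. apply Hl', Hs.
Qed.

Lemma upd_upd (x : nat -> R) (i : nat) (s t : R) : upd (upd x i s) i t = upd x i t.
Proof.
  apply functional_extensionality. intro j. unfold upd. now destruct (Nat.eqb j i).
Qed.

Lemma Roumieu_axis_jet (r : nat) (M : nat -> R) (b : (nat -> nat) -> R) :
  (1 <= r)%nat -> in_jet_Roumieu r M b -> axis_jet M b.
Proof.
  intros Hr (k & f & D & Hk & (_ & Hder & _) & HR & Hjet).
  assert (Hk0 : 0 < / INR k) by (apply Rinv_0_lt_compat, lt_0_INR; lia).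
  (* Halving keeps the closed segment inside the open cube. *)
  set (d := / INR k / 2).
  assert (Hcube : forall t, 0 <= t <= d -> cube r k (upd pzero 0 t)).
  { intros t Ht. split.
    - intros i Hi. unfold upd, pzero. destruct i; [lia|reflexivity].
    - intros i Hi. unfold upd, pzero. destruct i; simpl.
      + unfold d in Ht. rewrite Rabs_right; lra.
      + rewrite Rabs_R0. exact Hk0. }
  destruct (HR _ (compact_segment r d Hr ltac:(unfold d; lra))) as (h & Hh & C & HC).
  { intros x [t [Ht ->]]. now apply Hcube. }
  exists d, (fun p t => D (axis_index p) (upd pzero 0 t)), C, h.
  repeat split; try assumption.
  - unfold d; lra.
  - intros p t Ht.
    (* By conversion [mincr (axis_index p) 0] is [axis_index (S p)], the next order. *)
    assert (H := Hder (axis_index p) (mindex_axis r p Hr) 0%nat ltac:(lia) _ (Hcube t Ht)).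
    replace (fun s => D (axis_index p) (upd pzero 0 s))
      with (fun s => D (axis_index p) (upd (upd pzero 0 t) 0 s)); [exact H|].
    apply functional_extensionality. intro s. now rewrite upd_upd.
  - intros p t Ht.
    assert (H := HC (axis_index p) (mindex_axis r p Hr) (upd pzero 0 t)).
    rewrite (mlen_axis r p Hr) in H. apply H. now exists t.
  - intros p. rewrite (Hjet _ (mindex_axis r p Hr)), (mlen_axis r p Hr).
    replace (upd pzero 0 0) with pzero; [reflexivity|].
    apply functional_extensionality. intro i. unfold upd, pzero. now destruct (Nat.eqb i 0).
Qed.

(** * Linear structure of axis jets, the excluded sequence, and density *)

Lemma weighted_bound_mono (x C C' h h' : R) (M : nat -> R) (p : nat) :
  0 < M p -> C <= C' -> 0 <= C' -> 0 < h <= h' ->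
  x <= C * (h ^ p * M p) -> x <= C' * (h' ^ p * M p).
Proof.
  intros HM HC HC' Hh Hx. apply Rle_trans with (1 := Hx).
  assert (H1 := pow_incr h h' p ltac:(lra)). assert (H2 := pow_lt h p ltac:(lra)).
  apply Rle_trans with (C' * (h ^ p * M p)).
  - apply Rmult_le_compat_r; [apply Rmult_le_pos|]; lra.
  - apply Rmult_le_compat_l; [lra|]. apply Rmult_le_compat_r; lra.
Qed.

Lemma axis_jet_sub_scale (M : nat -> R) (b b' : (nat -> nat) -> R) (l : R) :
  (forall p, 0 < M p) -> axis_jet M b -> axis_jet M b' ->
  axis_jet M (fun a => l * (b a - b' a)).
Proof.
  intros HM (d & F & C & h & Hd & Hh & HF & HC & Hb)
    (d' & F' & C' & h' & Hd' & Hh' & HF' & HC' & Hb').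
  assert (H1 := Rmin_l d d'). assert (H2 := Rmin_r d d').
  assert (H3 := Rmax_l h h'). assert (H4 := Rmax_r h h').
  exists (Rmin d d'), (fun p t => l * (F p t - F' p t)),
    (Rabs l * (Rabs C + Rabs C')), (Rmax h h').
  split; [now apply Rmin_glb_lt|]. split; [lra|]. repeat split.
  - intros p t Ht. apply (derivable_pt_lim_scal (fun t => F p t - F' p t)).
    apply derivable_pt_lim_minus; [apply HF | apply HF']; lra.
  - intros p t Ht. rewrite Rabs_mult, Rmult_assoc.
    apply Rmult_le_compat_l; [apply Rabs_pos|].
    assert (HA : Rabs (F p t) <= Rabs C * (Rmax h h' ^ p * M p)).
    { apply weighted_bound_mono with C h; auto using RRle_abs, Rabs_pos; lra || apply HC; lra. }
    assert (HA' : Rabs (F' p t) <= Rabs C' * (Rmax h h' ^ p * M p)).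
    { apply weighted_bound_mono with C' h'; auto using RRle_abs, Rabs_pos; lra || apply HC'; lra. }
    assert (H := Rabs_triang (F p t) (- F' p t)). rewrite Rabs_Ropp in H.
    unfold Rminus. lra.
  - intros p. rewrite Hb, Hb'. unfold Rdiv. ring.
Qed.

Lemma axis_jet_nrm_false (r : nat) (M N : nat -> R) :
  (1 <= r)%nat -> weight_sequence M -> weight_sequence N -> quasianalytic M ->
  (forall B, exists k, (1 <= k)%nat /\ B < Rpower (nrm N k) (/ INR k)) ->
  ~ axis_jet M (fun a => nrm N (mlen r a)).
Proof.
  intros Hr (HM & _ & _ & HMlc & _) (HN & _) Hqa Hsup (d & F & C & h & Hd & Hh & HF & HC & Hb).
  assert (HF0 : forall p, 0 < F p 0).
  { intro p. assert (H := Hb p). rewrite (mlen_axis r p Hr) in H. unfold nrm in H.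
    assert (Hf := INR_fact_lt_0 p).
    apply Rmult_eq_reg_r in H; [|apply Rinv_neq_0_compat; lra].
    rewrite <- H. apply HN. }
  (* The constants are absorbed into the weight, which stays log-convex and quasianalytic; adding 1
     makes it strictly positive. *)
  set (W := fun p => (Rabs C + 1) * (h ^ p * M p)).
  assert (HC1 : 0 < Rabs C + 1) by (assert (H := Rabs_pos C); lra).
  assert (HW : forall p, 0 < W p).
  { intro p. assert (H := pow_lt h p Hh). apply Rmult_lt_0_compat; [lra|].
    now apply Rmult_lt_0_compat. }
  assert (HWlc : log_convex W).
  { intro p. unfold W. assert (H := HMlc (S p) ltac:(lia)).
    replace (S p - 1)%nat with p in H by lia. replace (S p + 1)%nat with (S (S p)) in H by lia.
    assert (Hp := pow_lt h p Hh).
    set (K := (Rabs C + 1) * (h * h ^ p)).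
    replace ((Rabs C + 1) * (h ^ S p * M (S p)) * ((Rabs C + 1) * (h ^ S p * M (S p))))
      with ((K * K) * (M (S p) ^ 2)) by (unfold K; simpl; ring).
    replace ((Rabs C + 1) * (h ^ p * M p) * ((Rabs C + 1) * (h ^ S (S p) * M (S (S p)))))
      with ((K * K) * (M p * M (S (S p)))) by (unfold K; simpl; ring).
    apply Rmult_le_compat_l; [apply Rle_0_sqr|exact H]. }
  assert (HFW : forall p t, 0 <= t <= d -> Rabs (F p t) <= W p).
  { intros p t Ht. apply weighted_bound_mono with C h; auto; try lra.
    assert (H := RRle_abs C). lra. }
  assert (Hnn : forall p t, 0 <= t <= d -> 0 <= F p t).
  { intros p t Ht.
    (* The nonnegativity lemma concerns order 0, so it is applied to the chain shifted by [p]. *)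
    assert (H := quasianalytic_nonneg d (fun j => W (p + j)%nat) (fun j => F (p + j)%nat)).
    simpl in H. rewrite Nat.add_0_r in H. apply H; auto.
    - intro q. rewrite <- !plus_n_Sm. apply HWlc.
    - apply (quasianalytic_shift W). now apply quasianalytic_scale.
    - intros q s Hs. rewrite <- plus_n_Sm. now apply HF. }
  (* Since [A >= 1], a [k] with $n_k^{1/k}>A/d$ gives $n_kd^k\ge A^k\ge A>F_0(d)$, against the
     Taylor bound. *)
  set (A := Rmax 1 (F 0%nat d) + 1).
  assert (HA1 : 1 <= A) by (assert (H := Rmax_l 1 (F 0%nat d)); unfold A; lra).
  assert (HA2 : F 0%nat d < A) by (assert (H := Rmax_r 1 (F 0%nat d)); unfold A; lra).
  destruct (Hsup (A / d)) as (k & Hk & Hlt).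
  assert (HT := nonneg_chain_taylor d F k 0 d HF Hnn ltac:(lra)). simpl in HT.
  assert (Hbk := Hb k). rewrite (mlen_axis r k Hr) in Hbk.
  assert (Hnk : 0 < nrm N k) by (apply Rdiv_lt_0_compat; [apply HN|apply INR_fact_lt_0]).
  assert (Hdk := pow_lt d k Hd).
  assert (HnA : nrm N k * d ^ k < A).
  { rewrite Hbk. unfold Rdiv in *. lra. }
  assert (Hroot : Rpower (nrm N k) (/ INR k) ^ k = nrm N k).
  { rewrite <- Rpower_pow by apply exp_pos. rewrite Rpower_mult, Rinv_l.
    - now apply Rpower_1.
    - apply not_0_INR. lia. }
  assert (HAd : 0 < A / d) by (apply Rdiv_lt_0_compat; lra).
  assert (Hpow : (A / d) ^ k <= nrm N k).
  { rewrite <- Hroot. apply pow_incr. lra. }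
  assert (HAk : A <= A ^ k).
  { rewrite <- (pow_1 A) at 1. apply Rle_pow; assumption. }
  assert (Heq : (A / d) ^ k * d ^ k = A ^ k).
  { rewrite <- Rpow_mult_distr. f_equal. field. lra. }
  nra.
Qed.

(** If [b] and [b] plus [eps] times the excluded sequence were both in [S], then [/ eps] times their
    difference would make that sequence an axis jet. *)
Lemma dense_complement (r : nat) (M N : nat -> R) (S : ((nat -> nat) -> R) -> Prop) :
  (1 <= r)%nat -> (forall p, 0 < M p) -> (forall p, 0 < N p) ->
  (forall b, S b -> axis_jet M b) ->
  ~ axis_jet M (fun a => nrm N (mlen r a)) ->
  dense_Lambda r N (fun b => ~ S b).
Proof.
  intros Hr HM HN HS Hn b (h & c & Hh & Hb) V [_ HV].
  assert (Hnrm : forall p, 0 < nrm N p)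
    by (intro p; apply Rdiv_lt_0_compat; [apply HN|apply INR_fact_lt_0]).
  (* The sequence $n_{|\alpha|}$ has norm 1 in the step [h = 1], so its multiple by [eps] lies in
     the ball contained in [V]. *)
  destruct (HV 1 ltac:(lra)) as (eps & Heps & Hball).
  destruct (classic (S b)) as [Hin | Hout].
  - exists (fun a => b a + eps * nrm N (mlen r a)). split; [|split].
    + exists (Rmax h 1), (Rabs c + eps).
      assert (H1 := Rmax_l h 1). assert (H2 := Rmax_r h 1).
      split; [lra|]. intros a Ha.
      assert (Hp := Hnrm (mlen r a)).
      assert (HA : Rabs (b a) <= Rabs c * (Rmax h 1 ^ mlen r a * nrm N (mlen r a))).
      { apply weighted_bound_mono with c h; auto using RRle_abs, Rabs_pos. }
      assert (HB : eps * nrm N (mlen r a) <= eps * (Rmax h 1 ^ mlen r a * nrm N (mlen r a))).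
      { apply weighted_bound_mono with eps 1; auto; try lra. rewrite pow1. lra. }
      assert (H := Rabs_triang (b a) (eps * nrm N (mlen r a))).
      rewrite (Rabs_right (eps * _)) in H by nra. lra.
    + intros Hin'. apply Hn.
      assert (H := axis_jet_sub_scale M _ _ (/ eps) HM (HS _ Hin') (HS _ Hin)).
      replace (fun a => nrm N (mlen r a))
        with (fun a => / eps * (b a + eps * nrm N (mlen r a) - b a)); [exact H|].
      apply functional_extensionality. intro a. field. lra.
    + apply Hball. intros a Ha. rewrite pow1, Rmult_1_l.
      assert (Hp := Hnrm (mlen r a)).
      rewrite Rabs_right; nra.
  - exists b. split; [now exists h, c|]. split; [exact Hout|].
    apply Hball. intros a Ha. assert (Hp := Hnrm (mlen r a)).
    rewrite Rminus_diag, Rabs_R0, pow1. nra.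
Qed.

Lemma Beurling_sub_Roumieu (r : nat) (M : nat -> R) (b : (nat -> nat) -> R) :
  in_jet_Beurling r M b -> in_jet_Roumieu r M b.
Proof.
  intros (k & f & D & Hk & HD & HB & Hj). exists k, f, D. repeat split; try apply HD; auto.
  intros K HK HU. exists 1. split; [lra|]. apply HB; auto. lra.
Qed.

Theorem mainTheorem6 (r : nat) (M N : nat -> R) :
  (1 <= r)%nat ->
  weight_sequence M -> weight_sequence N ->
  quasianalytic M -> quasianalytic N ->
  (* sup_{k > 0} n_k^{1/k} = +infinity *)
  (forall B, exists k, (1 <= k)%nat /\ B < Rpower (nrm N k) (/ INR k)) ->
  dense_Lambda r N (fun b => ~ in_jet_Roumieu r M b) /\
  dense_Lambda r N (fun b => ~ in_jet_Beurling r M b).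
Proof.
  intros Hr HM HN HqM _ Hsup.
  assert (Hn := axis_jet_nrm_false r M N Hr HM HN HqM Hsup).
  split; (apply (dense_complement r M N); [exact Hr|apply HM|apply HN| |exact Hn]); intros b Hb;
    apply (Roumieu_axis_jet r M b Hr); [exact Hb|now apply Beurling_sub_Roumieu].
Qed.
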